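(* Let $k$ be a field and let $I$ be the defining ideal of a scheme of $s+1$ general fat points in $\mathbb P^{n_1}\times\cdots\times\mathbb P^{n_r}$, where $s\le\min\{n_1,\dots,n_r\}$; that is, $I=I_{P_0}^{a_0}\cap\cdots\cap I_{P_s}^{a_s}$ with $a_0,\dots,a_s$ positive integers and $P_0,\dots,P_s$ distinct points in linear general position. Then, after a linear change of coordinates in each of the $r$ groups of variables taking the points to coordinate vertices (so that $I$ becomes a monomial ideal), $(I_d)$ is polymatroidal for all $d$; and $I$ is componentwise linear.
   Context: Let $r\ge 1$, $n_1,\dots,n_r\ge 1$. The coordinate ring of $\mathbb P^{n_1}\times\cdots\times\mathbb P^{n_r}$ (over $k$) is $R=k[x_{1,0},\dots,x_{1,n_1},\dots,x_{r,0},\dots,x_{r,n_r}]$, with $\mathbb N^r$-grading $\deg x_{i,j}=e_i$. The defining ideal of a point $P=P_1\times\cdots\times P_r$ is $I_P=(L_{1,1},\dots,L_{1,n_1},\dots,L_{r,1},\dots,L_{r,n_r})$, where $L_{i,1},\dots,L_{i,n_i}$ are linear forms in $x_{i,0},\dots,x_{i,n_i}$ generating the ideal of $P_i\in\mathbb P^{n_i}$. A $(d_1,\dots,d_r)$-linear subspace is $\mathcal L=\mathcal L_{d_1}\times\cdots\times\mathcal L_{d_r}$ where each $\mathcal L_{d_i}\subseteq\mathbb P^{n_i}$ is a linear subspace of dimension $d_i\in\{0,\dots,n_i\}$ and $d_j<n_j$ for at least one $j$. A set of points $X\subseteq\mathbb P^{n_1}\times\cdots\times\mathbb P^{n_r}$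 is in linear general position if every $(d_1,\dots,d_r)$-linear subspace $\mathcal L$ contains at most $d+1$ points of $X$, where $d=\min\{d_1,\dots,d_r\}$. (In particular distinct points of $X$ have distinct $i$-th coordinates for every $i$.) A set of fat points is general if its support is in linear general position. For the remaining notions $R$ carries the standard ($\mathbb N$-)grading by total degree. $(I_d)$ is the ideal generated by all elements of $I$ of degree $d$. A homogeneous ideal generated in degree $d$ has a linear resolution if its graded Betti numbers satisfy $\beta_{i,j}=0$ for all $j\ne i+d$; $I$ is componentwise linear if $(I_d)$ has a linear resolution for every $d$ (the zero ideal counts as having one). A monomial ideal $L$ generated in a single degree is polymatroidal if for any minimal monomial generators $u,v$ of $L$ and any variable $x$ whose exponent in $u$ is larger than in $v$, there is a variable $y$ whose exponent in $u$ is smaller than in $v$ with $yu/x\in L$ (the zero ideal is vacuously polymatroidal). *)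

(* Defs.v *)
From mathcomp Require Import all_boot all_order all_algebra.
From mathcomp Require Export mpoly.

Set Implicit Arguments.
Unset Strict Implicit.
Unset Printing Implicit Defensive.

Import GRing.Theory.
Local Open Scope ring_scope.

(* Ideals are Prop-valued predicates, compared extensionally by [ideal_eq]. *)

Definition ideal_eq (A : Type) (I J : A -> Prop) : Prop :=
  forall f, I f <-> J f.

Definition ideal_gen (A : comNzRingType) (S : A -> Prop) : A -> Prop :=
  fun f => exists (m : nat) (c g : 'I_m -> A),
    (forall t, S (g t)) /\ f = \sum_(t < m) c t * g t.

Definition ideal_pow (A : comNzRingType) (I : A -> Prop) (a : nat) :
    A -> Prop :=
  ideal_gen (fun f => exists g : 'I_a -> A,
    (forall t, I (g t)) /\ f = \prod_(t < a) g t).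

(* [component I d] is the ideal (I_d). *)
Definition component (k : fieldType) (N : nat) (I : {mpoly k[N]} -> Prop)
    (d : nat) : {mpoly k[N]} -> Prop :=
  ideal_gen (fun f => I f /\ f \is d.-homog).

Definition monomial_ideal (k : fieldType) (N : nat)
    (I : {mpoly k[N]} -> Prop) : Prop :=
  exists S : 'X_{1..N} -> Prop,
    ideal_eq I (ideal_gen (fun f => exists2 u, S u & f = 'X_[u])).

(* [(v <= u)%MM] is divisibility of monomials. *)
Definition min_generator (k : fieldType) (N : nat)
    (I : {mpoly k[N]} -> Prop) (u : 'X_{1..N}) : Prop :=
  I 'X_[u] /\ forall v : 'X_{1..N}, I 'X_[v] -> (v <= u)%MM -> v = u.

Definition polymatroidal (k : fieldType) (N : nat)
    (I : {mpoly k[N]} -> Prop) : Prop :=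
  [/\ monomial_ideal I,
      exists d : nat, ideal_eq I (component I d)
    & forall u v : 'X_{1..N}, min_generator I u -> min_generator I v ->
        forall x : 'I_N, (v x < u x)%N ->
        exists2 y : 'I_N, (u y < v y)%N & I 'X_[(u - U_(x) + U_(y))%MM]].

(* A minimal graded free resolution
     ... -> F_2 --D_1--> F_1 --D_0--> F_0 --G--> I -> 0
   of a homogeneous ideal, with F_i free on [frank i] generators, the p-th one
   being in degree [gdeg i p].  Elements of F_i are row vectors and the maps
   act by right multiplication, so D_i goes from F_(i+1) to F_i.  Finite length
   is not required: [frank i] may be 0 from some point on.  Minimality is
   D_i(F_(i+1)) <= m F_i, for m the ideal of the variables. *)
Record min_free_resolution (k : fieldType) (N : nat)
    (I : {mpoly k[N]} -> Prop) := MinFreeResolution {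
  frank : nat -> nat;
  gdeg : forall i : nat, 'I_(frank i) -> nat;
  aug : 'cV[{mpoly k[N]}]_(frank 0);
  fdiff : forall i : nat, 'M[{mpoly k[N]}]_(frank i.+1, frank i);
  aug_graded : forall (p : 'I_(frank 0)) (m : 'X_{1..N}),
    m \in msupp (aug p 0) -> mdeg m = gdeg p;
  diff_graded : forall (i : nat) (p : 'I_(frank i.+1)) (q : 'I_(frank i))
      (m : 'X_{1..N}),
    m \in msupp (fdiff i p q) -> (mdeg m + gdeg q)%N = gdeg p;
  diff_minimal : forall (i : nat) (p : 'I_(frank i.+1)) (q : 'I_(frank i)),
    (fdiff i p q)@_0%MM = 0;
  aug_onto : forall f : {mpoly k[N]},
    I f <-> exists v : 'rV_(frank 0), f = (v *m aug) 0 0;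
  exact_aug : forall v : 'rV_(frank 0),
    v *m aug = 0 <-> exists w : 'rV_(frank 1), v = w *m fdiff 0;
  exact_diff : forall (i : nat) (v : 'rV_(frank i.+1)),
    v *m fdiff i = 0 <-> exists w : 'rV_(frank i.+2), v = w *m fdiff i.+1
}.

(* The graded Betti number beta_(i,j), read off a minimal resolution (these
   are unique up to isomorphism). *)
Definition betti (k : fieldType) (N : nat) (I : {mpoly k[N]} -> Prop)
    (F : min_free_resolution I) (i j : nat) : nat :=
  #|[set p : 'I_(frank F i) | gdeg p == j]|.

(* The zero ideal satisfies this for every d, through the resolution all of
   whose ranks are 0. *)
Definition linear_resolution (k : fieldType) (N : nat)
    (I : {mpoly k[N]} -> Prop) (d : nat) : Prop :=
  exists F : min_free_resolution I,
    forall i j : nat, j <> (i + d)%N -> betti F i j = 0%N.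

Definition componentwise_linear (k : fieldType) (N : nat)
    (I : {mpoly k[N]} -> Prop) : Prop :=
  forall d : nat, linear_resolution (component I d) d.

(* Coordinates on P^(n_1) x ... x P^(n_r): the variable x_(i,j), for i < r and
   j <= n_i, is number [tagnat.Rank i j] in the concatenation of the r groups. *)

Definition nvars (r : nat) (n : 'I_r -> nat) : nat := (\sum_(i < r) (n i).+1)%N.

Definition xvar (k : fieldType) (r : nat) (n : 'I_r -> nat) (i : 'I_r)
    (j : 'I_(n i).+1) : {mpoly k[nvars n]} :=
  'X_(tagnat.Rank (p_ := fun i => (n i).+1) i j).

(* The inclusion k[x_(i,0), ..., x_(i,n_i)] into the full coordinate ring. *)
Definition incl (k : fieldType) (r : nat) (n : 'I_r -> nat) (i : 'I_r)
    (f : {mpoly k[(n i).+1]}) : {mpoly k[nvars n]} :=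
  f \mPo [tuple xvar k j | j < (n i).+1].

(* A point is given by homogeneous coordinates in each factor, its i-th
   coordinate being the line spanned by the row vector [P i]. *)
Definition mpoint (k : fieldType) (r : nat) (n : 'I_r -> nat) : Type :=
  forall i : 'I_r, 'rV[k]_(n i).+1.

Definition valid_point (k : fieldType) (r : nat) (n : 'I_r -> nat)
    (P : mpoint k n) : Prop :=
  forall i, P i != 0.

Definition same_point (k : fieldType) (r : nat) (n : 'I_r -> nat)
    (P Q : mpoint k n) : bool :=
  [forall i, (P i == Q i)%MS].

(* The homogeneous ideal of the point [p] of P^m. *)
Definition point_ideal (k : fieldType) (m : nat) (p : 'rV[k]_m.+1) :
    {mpoly k[m.+1]} -> Prop :=
  ideal_gen (fun f => (exists d : nat, f \is d.-homog) /\
                      f.@[fun j => p 0 j] = 0).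

Definition defining_forms (k : fieldType) (m : nat) (p : 'rV[k]_m.+1)
    (L : 'I_m -> {mpoly k[m.+1]}) : Prop :=
  (forall j, L j \is 1.-homog) /\
  ideal_eq (ideal_gen (fun f => exists j, f = L j)) (point_ideal p).

Definition mpoint_ideal (k : fieldType) (r : nat) (n : 'I_r -> nat)
    (L : forall i : 'I_r, 'I_(n i) -> {mpoly k[(n i).+1]}) :
    {mpoly k[nvars n]} -> Prop :=
  ideal_gen (fun f => exists (i : 'I_r) (j : 'I_(n i)), f = incl (L i j)).

Definition fat_points_ideal (k : fieldType) (r : nat) (n : 'I_r -> nat)
    (s : nat)
    (L : forall (l : 'I_s.+1) (i : 'I_r), 'I_(n i) -> {mpoly k[(n i).+1]})
    (a : 'I_s.+1 -> nat) : {mpoly k[nvars n]} -> Prop :=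
  fun f => forall l, ideal_pow (mpoint_ideal (L l)) (a l) f.

(* min{d_1, ..., d_r} for r >= 1; the neutral element does not affect it. *)
Definition min_dim (r : nat) (d : 'I_r -> nat) : nat :=
  \big[minn/(\max_(i < r) d i)%N]_(i < r) d i.

(* A linear subspace of P^(n_i) of dimension d_i is the row space of a matrix of
   rank d_i + 1.  The points of the family are assumed distinct, so that
   counting indices is counting points. *)
Definition linear_general_position (k : fieldType) (r : nat) (n : 'I_r -> nat)
    (s : nat) (P : 'I_s.+1 -> mpoint k n) : Prop :=
  forall (d : 'I_r -> nat) (U : forall i : 'I_r, 'M[k]_((n i).+1)),
    (forall i, (d i <= n i)%N) ->
    (exists j, (d j < n j)%N) ->
    (forall i, \rank (U i) = (d i).+1) ->
    (#|[set l | [forall i, (P l i <= U i)%MS]]| <= (min_dim d).+1)%N.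

(* A linear change of coordinates [g] sends the point p to p *m g i in the i-th
   factor, and a polynomial f to the polynomial f' with f'(p g) = f(p), obtained
   by substituting \sum_l (g_i^-1)_(l,j) x_(i,l) for x_(i,j). *)

Definition coord_change (k : fieldType) (r : nat) (n : 'I_r -> nat)
    (g : forall i : 'I_r, 'M[k]_((n i).+1)) (f : {mpoly k[nvars n]}) :
    {mpoly k[nvars n]} :=
  f \mPo [tuple let i := tagnat.sig1 v in
                \sum_(l < (n i).+1)
                  (invmx (g i) l (tagnat.sig2 v)) *: xvar k l
         | v < nvars n].

Definition transformed (k : fieldType) (r : nat) (n : 'I_r -> nat)
    (g : forall i : 'I_r, 'M[k]_((n i).+1)) (I : {mpoly k[nvars n]} -> Prop) :
    {mpoly k[nvars n]} -> Prop :=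
  fun h => exists2 f, I f & h = coord_change g f.

Definition takes_to_vertices (k : fieldType) (r : nat) (n : 'I_r -> nat)
    (s : nat) (P : 'I_s.+1 -> mpoint k n)
    (g : forall i : 'I_r, 'M[k]_((n i).+1)) : Prop :=
  (forall i, g i \in unitmx) /\
  forall l i, exists j : 'I_(n i).+1,
    (P l i *m g i == (delta_mx 0 j : 'rV[k]_(n i).+1))%MS.

(* Main.v *)
Require Import Defs.
From mathcomp Require Import all_boot all_order all_algebra.

Set Implicit Arguments.
Unset Strict Implicit.
Unset Printing Implicit Defensive.

Import GRing.Theory.
Local Open Scope ring_scope.

(* In linear general position the i-th coordinates of the points are linearly
   independent, so they can be moved to distinct coordinate vertices in every
   factor.  A linear form vanishing at a point goes to one vanishing at the
   vertex, hence I_P goes to the ideal of the variables outside a block A_l of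
   r variables (one for each factor), and the blocks of distinct points are
   disjoint.  So I becomes the ideal of the monomials u with
   deg u - u(A_l) >= a_l for all l.  In degree d this bounds the weight of each
   of finitely many disjoint blocks, from which the exchange property is read
   off.  The exchange property makes the generators, taken in increasing
   lexicographic order, have linear quotients: each colon ideal is generated by
   variables.  Mapping cones then build the linear resolution one generator at a
   time, the resolutions of the ideals of variables being obtained by the same
   construction. *)

(** * Ideals and monomial ideals *)

Section Ideals.
Variable A : comNzRingType.
Implicit Types (S I : A -> Prop).

Lemma ideal_gen_sub S f : S f -> ideal_gen S f.
Proof.
by move=> Sf; exists 1%N, (fun=> 1), (fun=> f); rewrite big_ord1 mul1r.
Qed.

Lemma ideal_gen0 S : ideal_gen S 0.
Proof. by exists 0%N, (fun=> 0), (fun=> 0); rewrite big_ord0; split=> // -[]. Qed.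

Lemma ideal_genD S f g : ideal_gen S f -> ideal_gen S g -> ideal_gen S (f + g).
Proof.
move=> [m [c [u [Su ->]]]] [m' [c' [u' [Su' ->]]]].
pose glue (w : 'I_m -> A) (w' : 'I_m' -> A) (t : 'I_(m + m')) :=
  match split t with inl i => w i | inr i => w' i end.
exists (m + m')%N, (glue c c'), (glue u u'); split.
  by move=> t; rewrite /glue; case: (split t).
by rewrite big_split_ord /glue; congr (_ + _); apply: eq_bigr => i _;
   rewrite ?lshiftK ?rshiftK (unsplitK (inl i), unsplitK (inr i)).
Qed.

Lemma ideal_genMl S f g : ideal_gen S g -> ideal_gen S (f * g).
Proof.
move=> [m [c [u [Su ->]]]]; exists m, (fun t => f * c t), u; split=> //.
by rewrite mulr_sumr; apply: eq_bigr => i _; rewrite mulrA.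
Qed.

Lemma ideal_gen_sum S (T : eqType) (r : seq T) (F : T -> A) :
  (forall t, t \in r -> ideal_gen S (F t)) -> ideal_gen S (\sum_(t <- r) F t).
Proof.
elim: r => [|x r IH] SF; first by rewrite big_nil; exact: ideal_gen0.
rewrite big_cons; apply: ideal_genD; first by apply: SF; rewrite mem_head.
by apply: IH => t tr; apply: SF; rewrite in_cons tr orbT.
Qed.

Lemma ideal_gen_ind S (Q : A -> Prop) : Q 0 ->
  (forall f g, Q f -> Q g -> Q (f + g)) -> (forall c g, S g -> Q (c * g)) ->
  forall f, ideal_gen S f -> Q f.
Proof. by move=> Q0 QD QM f [m [c [g [Sg ->]]]]; apply: big_ind => // i _; apply: QM. Qed.

Lemma ideal_gen_sub_gen S S' :
  (forall f, S f -> ideal_gen S' f) -> forall f, ideal_gen S f -> ideal_gen S' f.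
Proof.
move=> SS'; apply: ideal_gen_ind; [exact: ideal_gen0 | exact: ideal_genD |].
by move=> c g /SS'; apply: ideal_genMl.
Qed.

Lemma ideal_pow_prod I a (g : 'I_a -> A) :
  (forall t, I (g t)) -> ideal_pow I a (\prod_t g t).
Proof. by move=> Ig; apply: ideal_gen_sub; exists g. Qed.

Lemma ideal_powSl I a f g : I f -> ideal_pow I a g -> ideal_pow I a.+1 (f * g).
Proof.
move=> If; move: g; apply: ideal_gen_ind.
- by rewrite mulr0; exact: ideal_gen0.
- by move=> g g'; rewrite mulrDr; exact: ideal_genD.
move=> c _ [g [Ig ->]]; rewrite mulrCA; apply: ideal_genMl.
have -> : f * \prod_t g t
    = \prod_(t < a.+1) (if unlift ord0 t is Some u then g u else f).
  by rewrite big_ord_recl unlift_none; congr (_ * _); apply: eq_bigr => i _; rewrite liftK.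
by apply: ideal_pow_prod => t; case: unliftP.
Qed.

End Ideals.

Section RingMorphism.
Variables (A B : comNzRingType) (phi : {rmorphism A -> B}).

Lemma rmorph_ideal_gen (S : A -> Prop) (S' : B -> Prop) :
  (forall f, S f -> ideal_gen S' (phi f)) ->
  forall f, ideal_gen S f -> ideal_gen S' (phi f).
Proof.
move=> SS'; apply: ideal_gen_ind.
- by rewrite rmorph0; exact: ideal_gen0.
- by move=> f g; rewrite rmorphD; exact: ideal_genD.
by move=> c g /SS' Sg; rewrite rmorphM; apply: ideal_genMl.
Qed.

Lemma rmorph_ideal_pow (I : A -> Prop) (I' : B -> Prop) a :
  (forall f, I f -> I' (phi f)) ->
  forall f, ideal_pow I a f -> ideal_pow I' a (phi f).
Proof.
move=> II'; apply: rmorph_ideal_gen => _ [g [Ig ->]].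
by rewrite rmorph_prod; apply: ideal_pow_prod => t; apply: II'.
Qed.

End RingMorphism.

Section MonomialIdeals.
Variables (k : fieldType) (N : nat).
Implicit Types (f g : {mpoly k[N]}) (m u v : 'X_{1..N}) (S T : 'X_{1..N} -> Prop).

Definition mono_ideal S : {mpoly k[N]} -> Prop :=
  ideal_gen (fun f => exists2 u, S u & f = 'X_[u]).

Definition up_closed T := forall m m', T m -> T (m + m')%MM.

Lemma supp_closedM T f g : up_closed T -> (forall m, m \in msupp g -> T m) ->
  forall m, m \in msupp (f * g) -> T m.
Proof.
move=> upT Tg m /msuppM_le /allpairsP[[m1 m2] /= [m1f m2g ->]].
by rewrite addmC; apply/upT/Tg.
Qed.

Lemma ideal_gen_supp T (S : {mpoly k[N]} -> Prop) : up_closed T ->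
  (forall f, S f -> forall m, m \in msupp f -> T m) ->
  forall f, ideal_gen S f -> forall m, m \in msupp f -> T m.
Proof.
move=> upT TS; apply: (@ideal_gen_ind _ _ (fun f => forall m, m \in msupp f -> T m)).
- by rewrite msupp0.
- by move=> f g Tf Tg m /msuppD_le; rewrite mem_cat => /orP[/Tf|/Tg].
by move=> c g /TS Tg; apply: supp_closedM.
Qed.

Lemma ideal_gen_of_supp (S : {mpoly k[N]} -> Prop) f :
  (forall m, m \in msupp f -> ideal_gen S 'X_[m]) -> ideal_gen S f.
Proof.
move=> Sf; rewrite [f]mpolyE; apply: ideal_gen_sum => m /Sf Sm.
by rewrite -mul_mpolyC; apply: ideal_genMl.
Qed.

Lemma mono_idealP S f :
  mono_ideal S f <-> forall m, m \in msupp f -> exists2 u, S u & (u <= m)%MM.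
Proof.
split.
  move: f; apply: ideal_gen_supp.
    by move=> m m' [u Su um]; exists u => //; apply: lepm_trans um (lem_addr _ _).
  by move=> _ [u Su ->] m; rewrite msuppX inE => /eqP->; exists u => //; exact: lepm_refl.
move=> Sf; apply: ideal_gen_of_supp => m /Sf[u Su um].
rewrite -(submK um) mpolyXD; apply: ideal_genMl.
by apply: ideal_gen_sub; exists u.
Qed.

Lemma mono_idealX S m : mono_ideal S 'X_[m] <-> exists2 u, S u & (u <= m)%MM.
Proof.
rewrite mono_idealP; split=> [|Sm m']; first by apply; rewrite msuppX mem_head.
by rewrite msuppX inE => /eqP->.
Qed.

Lemma up_closed_mono_ideal T f : up_closed T ->
  mono_ideal T f <-> forall m, m \in msupp f -> T m.
Proof.
move=> upT; rewrite mono_idealP; split=> Tf m /Tf; last by exists m; rewrite ?lepm_refl.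
by case=> u Tu /submK <-; rewrite addmC; apply: upT.
Qed.

(** As [T] is upward closed, every monomial of an element of the ideal lies in [T]; for a form of
    degree [d] these monomials also have degree [d], so they generate it. *)
Lemma component_mono_ideal T d f : up_closed T ->
  component (mono_ideal T) d f <-> mono_ideal (fun u => T u /\ mdeg u = d) f.
Proof.
move=> upT; split.
  apply: ideal_gen_sub_gen => g [/(up_closed_mono_ideal _ upT) Tg /dhomogP hg].
  apply: ideal_gen_of_supp => m mg; apply: ideal_gen_sub; exists m => //.
  by split; [exact: Tg | exact: hg].
apply: ideal_gen_sub_gen => _ [u [Tu du] ->]; apply: ideal_gen_sub.
by split; [apply: ideal_gen_sub; exists u | rewrite dhomogX; apply/eqP].
Qed.

End MonomialIdeals.
(** * Linear resolutions and mapping cones *)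

Section LinearComplexes.
Variables (k : fieldType) (N : nat).
Notation R := {mpoly k[N]}.
Implicit Types (I : R -> Prop) (d e t : nat).

Definition homog_mx d m n (M : 'M[R]_(m, n)) : bool :=
  [forall p, forall q, M p q \is d.-homog].

Lemma homog_mxP d m n (M : 'M[R]_(m, n)) :
  reflect (forall p q, M p q \is d.-homog) (homog_mx d M).
Proof. by apply: (iffP forallP) => H p; apply/forallP. Qed.

Lemma homog_mx_mul d e m n p (M : 'M[R]_(m, n)) (M' : 'M_(n, p)) :
  homog_mx d M -> homog_mx e M' -> homog_mx (d + e) (M *m M').
Proof.
move=> /homog_mxP hM /homog_mxP hM'; apply/homog_mxP => i j; rewrite mxE.
by apply: rpred_sum => l _; apply: dhomogM.
Qed.

Lemma homog_mxN m n (M : 'M[R]_(m, n)) e : homog_mx e M -> homog_mx e (- M).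
Proof. by move=> /homog_mxP hM; apply/homog_mxP => i j; rewrite mxE rpredN. Qed.

Lemma homog_block e m1 m2 n1 n2 (M1 : 'M[R]_(m1, n1)) (M3 : 'M[R]_(m2, n1))
    (M4 : 'M[R]_(m2, n2)) :
  homog_mx e M1 -> homog_mx e M3 -> homog_mx e M4 -> homog_mx e (block_mx M1 0 M3 M4).
Proof.
move=> /homog_mxP h1 /homog_mxP h3 /homog_mxP h4; apply/homog_mxP => i j.
by rewrite mxE; case: (split i) => p; rewrite mxE; case: (split j) => q //;
   rewrite mxE dhomog0.
Qed.

Lemma pihomogMr t e (f g : R) :
  g \is e.-homog -> pihomog mdeg (t + e) (f * g) = pihomog mdeg t f * g.
Proof.
move=> hg; rewrite [f]mpolyE mulr_suml !raddf_sum /= mulr_suml.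
apply: eq_bigr => m _; rewrite -scalerAl !linearZ /= -scalerAl; congr (_ *: _).
rewrite pihomogX; have hm : 'X_[m] * g \is (mdeg m + e).-homog.
  by apply: dhomogM; rewrite ?dhomogX.
case: eqP => [<-|/eqP ne]; first exact: pihomog_dE.
by rewrite mul0r (pihomog_ne0 _ hm) // eqn_add2r.
Qed.

(** Only the degree-[t] part of [W] contributes to degree [t + e] of the product, so the other parts
    may be dropped. This keeps the comparison maps linear. *)
Lemma homog_lift t e m n p (W : 'M[R]_(m, n)) (D : 'M_(n, p)) :
  homog_mx e D -> homog_mx (t + e) (W *m D) ->
  exists2 W' : 'M_(m, n), homog_mx t W' & W *m D = W' *m D.
Proof.
move=> /homog_mxP hD /homog_mxP hWD; exists (map_mx (pihomog mdeg t) W).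
  by apply/homog_mxP => i j; rewrite mxE pihomogP.
apply/matrixP => i j; rewrite -(pihomog_dE (hWD i j)) !mxE raddf_sum /=.
by apply: eq_bigr => l _; rewrite mxE (pihomogMr _ _ (hD l j)).
Qed.

Lemma factor_rows m n p (M : 'M[R]_(m, p)) (D : 'M_(n, p)) :
  (forall i, exists w : 'rV_n, row i M = w *m D) -> exists W, M = W *m D.
Proof.
move=> /fin_all_exists[w wE]; exists (\matrix_i w i).
by apply/row_matrixP => i; rewrite wE row_mul rowK.
Qed.

(* The maps of a linear resolution; minimality is automatic since the
   differentials have entries of degree 1. *)
Record linear_complex I d (b : nat -> nat) (A : 'cV[R]_(b 0%N))
    (D : forall i, 'M[R]_(b i.+1, b i)) : Prop := LinearComplex {
  lc_aug : homog_mx d A;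
  lc_diff : forall i, homog_mx 1 (D i);
  lc_onto : forall f, I f <-> exists v : 'rV_(b 0%N), f = (v *m A) 0 0;
  lc_exact0 : forall v : 'rV_(b 0%N),
    v *m A = 0 <-> exists w : 'rV_(b 1%N), v = w *m D 0%N;
  lc_exact : forall i (v : 'rV_(b i.+1)),
    v *m D i = 0 <-> exists w : 'rV_(b i.+2), v = w *m D i.+1 }.

Definition linearly_resolved d I : Prop := exists b A D, @linear_complex I d b A D.

Lemma linearly_resolved_eq d I I' :
  ideal_eq I I' -> linearly_resolved d I -> linearly_resolved d I'.
Proof.
move=> II' [b [A [D [hA hD onto ex0 ex]]]]; exists b, A, D; split=> // f.
by rewrite -onto; split=> /II'.
Qed.

Lemma linearly_resolved_resolution d I :
  linearly_resolved d I -> linear_resolution I d.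
Proof.
move=> [b [A [D [/homog_mxP hA hD onto ex0 ex]]]].
have hD1 i p q m : m \in msupp (D i p q) -> mdeg m = 1%N.
  by move=> mD; move/homog_mxP: (hD i) => /(_ p q)/dhomogP; apply.
(* All generators of the [i]-th module are placed in degree [i + d], which fits since the
   augmentation has entries of degree [d] and the differentials of degree 1. *)
unshelve eexists (@MinFreeResolution k N I b (fun i _ => i + d)%N A D _ _ _ onto ex0 ex).
- by move=> p m mA; move/dhomogP: (hA p 0) => /(_ m mA).
- by move=> i p q m /hD1->.
- by move=> i p q; apply/eqP; rewrite mcoeff_eq0; apply/negP => /hD1; rewrite mdeg0.
move=> i j ij; apply/eqP; rewrite cards_eq0; apply/eqP/setP => p.
by rewrite !inE /=; apply/eqP => ji; apply: ij.
Qed.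

Lemma linearly_resolved0 d I : (forall f, I f <-> f = 0) -> linearly_resolved d I.
Proof.
move=> I0; exists (fun=> 0%N), 0, (fun=> 0); split.
- by apply/homog_mxP => -[].
- by move=> i; apply/homog_mxP => -[].
- move=> f; rewrite I0; split=> [->|[v ->]]; first by exists 0; rewrite mulmx0 mxE.
  by rewrite mulmx0 mxE.
- by move=> v; split=> _; [exists 0; rewrite mulmx0; exact: thinmx0 | rewrite mulmx0].
- by move=> i v; split=> _; [exists 0; rewrite mulmx0; exact: thinmx0 | rewrite mulmx0].
Qed.

Lemma lc_mul_diff I d b A D : @linear_complex I d b A D ->
  forall i, D i.+1 *m D i = 0.
Proof.
move=> C i; apply/row_matrixP => p; rewrite row0 row_mul; apply/(lc_exact C).
by exists (delta_mx 0 p); rewrite rowE.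
Qed.

Lemma lc_mul_aug I d b A D : @linear_complex I d b A D -> D 0%N *m A = 0.
Proof.
move=> C; apply/row_matrixP => p; rewrite row0 row_mul; apply/(lc_exact0 C).
by exists (delta_mx 0 p); rewrite rowE.
Qed.

(** * The mapping cone over a colon ideal *)

Section Comparison.
Variables (I J : R -> Prop) (d : nat) (f : R).
Hypotheses (hf : f \is d.-homog) (JE : forall g, J g <-> I (g * f)).
Variables (b : nat -> nat) (A : 'cV[R]_(b 0%N)) (D : forall i, 'M[R]_(b i.+1, b i)).
Variables (c : nat -> nat) (B : 'cV[R]_(c 0%N)) (E : forall i, 'M[R]_(c i.+1, c i)).
Hypotheses (CI : linear_complex I d A D) (CJ : linear_complex J 1 B E).

(* Consecutive comparison maps (phi_i, phi_(i+1)); carrying the second one makes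
   the extendability of phi_i a decidable condition, as [xchoose] requires. *)
Definition square i (x : 'M[R]_(c i, b i) * 'M[R]_(c i.+1, b i.+1)) : bool :=
  [&& homog_mx 1 x.1, homog_mx 1 x.2 & E i *m x.1 == x.2 *m D i].

(** The composite [E i.+1 *m x.2] is killed by [D i], since the given square commutes and
    consecutive maps [E] compose to zero; exactness then lifts it through [D i.+1]. *)
Lemma square_next i x : square x ->
  exists y, square (i := i.+1) (x.2, y).
Proof.
case/and3P=> h1 h2 /eqP sq.
have [W WE] : exists W, E i.+1 *m x.2 = W *m D i.+1.
  apply: factor_rows => p; apply/(lc_exact CI).
  by rewrite -row_mul -mulmxA -sq mulmxA (lc_mul_diff CJ) mul0mx row0.
have [] := @homog_lift 1 1 _ _ _ W (D i.+1) (lc_diff CI _).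
  by rewrite -WE homog_mx_mul ?(lc_diff CJ).
by move=> y hy yE; exists y; rewrite /square /= h2 hy WE yE eqxx.
Qed.

(** The entries of [B] lie in [J], the colon ideal of [I] by [f]; multiplied by [f] they lie in [I]
    and hence factor through [A]. *)
Lemma square0 : exists x, (square (i := 0%N) x) && (x.1 *m A == B *m f%:M).
Proof.
have hfB : homog_mx (1 + d) (B *m f%:M).
  apply: homog_mx_mul (lc_aug CJ) _; apply/homog_mxP => i j.
  by rewrite mxE; case: eqP => _; rewrite ?mulr1n ?mulr0n ?dhomog0.
have [W WE] : exists W, B *m f%:M = W *m A.
  apply: factor_rows => p.
  have : J (B p 0).
    by apply/(lc_onto CJ); exists (delta_mx 0 p); rewrite -rowE mxE.
  move=> /JE /(lc_onto CI) [w wE]; exists w; apply/matrixP => i j.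
  by rewrite !ord1 -wE mul_mx_scalar !mxE mulrC.
have [|phi hphi phiE] := homog_lift (t := 1) (lc_aug CI) (W := W); first by rewrite -WE.
have [W' W'E] : exists W', E 0%N *m phi = W' *m D 0%N.
  apply: factor_rows => p; apply/(lc_exact0 CI).
  by rewrite -row_mul -mulmxA -phiE -WE mulmxA (lc_mul_aug CJ) mul0mx row0.
have [] := @homog_lift 1 1 _ _ _ W' (D 0%N) (lc_diff CI _).
  by rewrite -W'E homog_mx_mul ?(lc_diff CJ).
move=> y hy yE; exists (phi, y); rewrite /square /= hphi hy W'E yE eqxx.
by rewrite WE phiE eqxx.
Qed.

Fixpoint squares i : {x | square (i := i) x} :=
  match i with
  | 0 => exist _ (xchoose square0) (proj1 (andP (xchooseP square0)))
  | j.+1 => let: exist x sx := squares j in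
            exist _ (x.2, xchoose (square_next sx)) (xchooseP (square_next sx))
  end.

Lemma comparison : exists phi : forall i, 'M[R]_(c i, b i),
  [/\ forall i, homog_mx 1 (phi i), phi 0%N *m A = B *m f%:M
    & forall i, E i *m phi i = phi i.+1 *m D i].
Proof.
exists (fun i => (sval (squares i)).1); split.
- by move=> i; case: (squares i) => x /= /and3P[].
- by rewrite /=; case/andP: (xchooseP square0) => _ /eqP.
by move=> i /=; case: (squares i) => x /= /and3P[_ _ /eqP].
Qed.

(** The resolution of [J], preceded by the ring itself, is added with its index unshifted at the
    ring: the rank 1 at index 0 is the new generator [f], and [c j] appears at index [j.+1]. *)
Definition cone_rank i : nat := b i + (if i is j.+1 then c j else 1%N).

Definition cone_aug : 'cV[R]_(cone_rank 0) := col_mx A (f%:M : 'cV_1).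

Definition cone_diff (phi : forall i, 'M[R]_(c i, b i)) i :
    'M[R]_(cone_rank i.+1, cone_rank i) :=
  match i with
  | 0 => block_mx (D 0%N) 0 (phi 0%N) (- B)
  | j.+1 => block_mx (D j.+1) 0 (phi j.+1) (- E j)
  end.

Lemma cone_complex I' : (forall g, I' g <-> exists2 h, I h & exists c, g = h + c * f) ->
  linearly_resolved d I'.
Proof.
move=> I'E; have [phi [hphi phi0 phiS]] := comparison.
exists cone_rank, cone_aug, (cone_diff phi); split.
- apply/homog_mxP => i j; rewrite mxE; case: (split i) => p.
    exact/homog_mxP/(lc_aug CI).
  by rewrite mxE; case: eqP => _; rewrite ?mulr1n ?mulr0n ?dhomog0.
- by case=> [|i]; apply: homog_block; rewrite ?homog_mxN ?(lc_diff CI) ?(lc_diff CJ) ?(lc_aug CJ).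
- move=> g; rewrite I'E; split.
    move=> [h /(lc_onto CI)[v ->] [e ->]]; exists (row_mx v e%:M).
    by rewrite mul_row_col -scalar_mxM [RHS]mxE [X in _ = _ + X]mxE eqxx mulr1n.
  move=> [v ->]; exists ((lsubmx v *m A) 0 0).
    by apply/(lc_onto CI); exists (lsubmx v).
  exists (rsubmx v 0 0); rewrite -{1}[v]hsubmxK mul_row_col mxE; congr (_ + _).
  by rewrite mul_mx_scalar mxE mulrC.
- move=> v; rewrite -[v]hsubmxK; set u := lsubmx v; set w := rsubmx v.
  rewrite /cone_aug mul_row_col; split.
    move=> uw0.
    (* A relation [u *m A + w *m f%:M = 0] puts the multiple of [f] by the entry of [w] in [I],
       hence that entry in [J]. Writing [w] as [z *m B] and correcting [u] by [z *m phi 0] leaves a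
       relation on [A] alone. *)
    have /(lc_onto CJ)[z wz] : J (w 0 0).
      apply/JE/(lc_onto CI); exists (- u).
      by rewrite mulNmx (addr0_eq uw0) mul_mx_scalar [RHS]mxE mulrC.
    have {}wz : w = z *m B by apply/matrixP => i j; rewrite !ord1.
    have /(lc_exact0 CI)[y yE] : (u + z *m phi 0%N) *m A = 0.
      by rewrite mulmxDl -mulmxA phi0 mulmxA -wz.
    exists (row_mx y (- z)); rewrite /cone_diff mul_row_block mulmx0 add0r.
    by rewrite !mulNmx mulmxN opprK -yE addrK wz.
  move=> [y]; rewrite -[y]hsubmxK /cone_diff mul_row_block mulmx0 add0r.
  case/eq_row_mx=> -> ->; rewrite mulmxDl -!mulmxA phi0 (lc_mul_aug CI).
  by rewrite mulNmx !mulmxN !mulmxA mulmx0 add0r subrr.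
(* The differentials of the cone differ only in the lower right block: [X] stands for [B] at index 0
   and for [E j] at index [j.+1]. *)
have main i (u : 'rV_(b i.+1)) (w : 'rV_(c i))
    (X : 'M[R]_(c i, if i is j.+1 then c j else 1%N)) :
    (forall v : 'rV_(c i), v *m X = 0 <-> exists w, v = w *m E i) ->
  (row_mx u w *m block_mx (D i) 0 (phi i) (- X) = 0 <->
     exists y, row_mx u w = y *m cone_diff phi i.+1).
  move=> exX; rewrite mul_row_block mulmx0 add0r; split.
    move=> /eqP; rewrite row_mx_eq0 mulmxN oppr_eq0 => /andP[/eqP uw0 /eqP/exX[z wz]].
    have /(lc_exact CI)[y yE] : (u + z *m phi i.+1) *m D i = 0.
      by rewrite mulmxDl -mulmxA -phiS mulmxA -wz.
    exists (row_mx y (- z)); rewrite /cone_diff mul_row_block mulmx0 add0r.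
    by rewrite !mulNmx mulmxN opprK -yE addrK wz.
  move=> [y]; rewrite -[y]hsubmxK /cone_diff mul_row_block mulmx0 add0r.
  case/eq_row_mx=> -> ->; rewrite -[RHS]row_mx0; congr row_mx.
    rewrite mulmxDl -!mulmxA (lc_mul_diff CI) -phiS mulmx0 add0r.
    by rewrite mulNmx mulmxN subrr.
  by rewrite !mulmxN mulNmx opprK; apply/exX; exists (rsubmx y).
case=> [|i] v; rewrite -[v]hsubmxK; apply: main.
  exact: lc_exact0 CJ.
by move=> w; apply: (lc_exact CJ).
Qed.

End Comparison.

Lemma linearly_resolved_cone d I I' (f : R) : f \is d.-homog ->
  linearly_resolved d I -> linearly_resolved 1 (fun g => I (g * f)) ->
  (forall g, I' g <-> exists2 h, I h & exists c, g = h + c * f) ->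
  linearly_resolved d I'.
Proof.
move=> hf [b [A [D CI]]] [c [B [E CJ]]].
exact: (cone_complex hf _ CI CJ).
Qed.

End LinearComplexes.
(** * Linear quotients *)

Section LinearQuotients.
Variables (k : fieldType) (N : nat).
Implicit Types (m u v w : 'X_{1..N}) (S : 'X_{1..N} -> Prop) (xs : seq 'I_N).

Lemma eq_mono_ideal S S' :
  (forall u, S u <-> S' u) -> ideal_eq (mono_ideal (k := k) S) (mono_ideal S').
Proof.
by move=> SS' f; split; apply: ideal_gen_sub_gen => g [u /SS' Su ->];
   apply: ideal_gen_sub; exists u.
Qed.

Lemma mono_ideal_add S u (g : {mpoly k[N]}) :
  mono_ideal (fun m => S m \/ m = u) g <->
  exists2 h, mono_ideal S h & exists c, g = h + c * 'X_[u].
Proof.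
split.
  move: g; apply: ideal_gen_ind.
  - by exists 0; [exact: ideal_gen0 | exists 0; rewrite mul0r addr0].
  - move=> _ _ [h Sh [c ->]] [h' Sh' [c' ->]]; exists (h + h').
      exact: ideal_genD.
    by exists (c + c'); rewrite mulrDl addrACA.
  move=> c _ [v Suv ->]; case: Suv => [Sv|->].
    exists (c * 'X_[v]); first by apply/ideal_genMl/ideal_gen_sub; exists v.
    by exists 0; rewrite mul0r addr0.
  by exists 0; [exact: ideal_gen0 | exists c; rewrite add0r].
move=> [h Sh [c ->]]; apply: ideal_genD.
  by apply: ideal_gen_sub_gen Sh => _ [v Sv ->]; apply: ideal_gen_sub; exists v; first left.
by apply/ideal_genMl/ideal_gen_sub; exists u; first right.
Qed.

Lemma mono_ideal_colon S u (g : {mpoly k[N]}) :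
  mono_ideal S (g * 'X_[u]) <->
  forall m, m \in msupp g -> exists2 v, S v & (v <= m + u)%MM.
Proof.
rewrite mono_idealP; split=> Sg m.
  move=> mg; apply: Sg; rewrite (perm_mem (msuppMX _ _)).
  by apply/mapP; exists m => //; rewrite addmC.
by rewrite (perm_mem (msuppMX _ _)) => /mapP[m' /Sg + ->]; rewrite addmC.
Qed.

Definition variable_in xs m : Prop := exists2 i, i \in xs & m = U_(i)%MM.

(** If [x] is not among [xs], the colon ideal of [(xs)] by [x] is [(xs)] itself, so the induction
    hypothesis supplies both complexes of the cone. A repeated variable does not change the
    ideal. *)
Lemma linearly_resolved_variables xs :
  linearly_resolved 1 (mono_ideal (k := k) (variable_in xs)).
Proof.
elim: xs => [|x xs IH].
  apply: linearly_resolved0 => f; split=> [|->]; last exact: ideal_gen0.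
  move/mono_idealP => f0; apply: msuppnil0; case: (msupp f) f0 => // m r.
  by move=> /(_ m (mem_head _ _))[u []].
have varE m : variable_in (x :: xs) m <-> variable_in xs m \/ m = U_(x)%MM.
  split=> [[i]|]; first by rewrite inE => /orP[/eqP->|ixs] ->; [right | left; exists i].
  case=> [[i ixs ->]|->]; first by exists i; rewrite // inE ixs orbT.
  by exists x; rewrite // mem_head.
have [xxs|xxs] := boolP (x \in xs).
  apply: linearly_resolved_eq IH => f; apply: eq_mono_ideal => u.
  by rewrite varE; split=> [|[//|->]]; [left | exists x].
have hx : ('X_x : {mpoly k[N]}) \is 1.-homog by rewrite dhomogX; apply/eqP/mdeg1.
apply: (linearly_resolved_cone hx IH); last first.
  move=> g; rewrite -mono_ideal_add; exact: eq_mono_ideal.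
apply: linearly_resolved_eq IH => g; rewrite mono_ideal_colon mono_idealP.
split=> H m /H [_ [i ixs ->] im]; exists U_(i)%MM; try by exists i.
  exact: lepm_trans im (lem_addr _ _).
move: im; rewrite !lep1mP mnmDE mnm1E; case: (x =P i) => [xi|_]; last by rewrite /= addn0.
by rewrite xi ixs in xxs.
Qed.

(** A combinatorial form of the requirement that the colon ideal of the generators below [v] by [v]
    be generated by variables: any multiplier of [v] into the ideal of such a [w] is divisible by
    the variable [y], which itself multiplies [v] into the ideal of a generator [w'] below [v]. *)
Definition linear_quotients (s : seq 'X_{1..N}) : Prop :=
  forall v w, v \in s -> w \in s -> (w < v)%O ->
    exists y, (v y < w y)%N /\
      exists2 w', w' \in s & (w' < v)%O /\ (w' <= v + U_(y))%MM.

Lemma linearly_resolved_quotients d (s : seq 'X_{1..N}) :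
  pairwise <%O s -> (forall u, u \in s -> mdeg u = d) -> linear_quotients s ->
  linearly_resolved d (mono_ideal (k := k) (fun u => u \in s)).
Proof.
elim/last_ind: s => [|s u IH].
  move=> _ _ _; apply: linearly_resolved0 => f; split=> [|->]; last exact: ideal_gen0.
  move/mono_idealP => f0; apply: msuppnil0; case: (msupp f) f0 => // m r.
  by move=> /(_ m (mem_head _ _))[u].
rewrite pairwise_rcons => /andP[/allP su pws] ds lq.
have memE v : (v \in rcons s u) <-> v \in s \/ v = u.
  by rewrite mem_rcons inE; split=> [/orP[/eqP|]|[->|->]]; rewrite ?eqxx ?orbT; auto.
have lt_mem v : v \in rcons s u -> (v < u)%O -> v \in s.
  by move/memE => [//|->]; rewrite Order.POrderTheory.ltxx.
have du : mdeg u = d by apply: ds; rewrite mem_rcons mem_head.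
have hu : ('X_[u] : {mpoly k[N]}) \is d.-homog by rewrite dhomogX; apply/eqP.
apply: (linearly_resolved_cone hu (I := mono_ideal (fun v => v \in s))); last first.
- move=> g; rewrite -mono_ideal_add; exact: eq_mono_ideal.
(* The variables that multiply [u] into the ideal of [s]; they generate the whole colon ideal. *)
- pose xs := [seq y <- enum 'I_N | has (fun v => (v <= u + U_(y))%MM) s].
  apply: linearly_resolved_eq (linearly_resolved_variables xs) => g.
  rewrite mono_ideal_colon mono_idealP; split=> H m /H.
    move=> [_ [i + ->] im]; rewrite mem_filter => /andP[/hasP[v vs vu] _].
    exists v => //; apply: lepm_trans vu _; rewrite addmC.
    by apply/mnm_lepP => j; rewrite !mnmDE leq_add2r; apply: (mnm_lepP im).
  move=> [v vs vm]; have vu := su _ vs.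
  have [||y [uv [w ws [wu wy]]]] := lq u v _ _ vu.
  + by rewrite mem_rcons mem_head.
  + by rewrite mem_rcons inE vs orbT.
  (* As [v] divides [m + u] and has more of [y] than [u] does, [y] must occur in [m]. *)
  exists U_(y)%MM; last first.
    rewrite lep1mP -lt0n; move/mnm_lepP: vm => /(_ y); rewrite mnmDE.
    by case: (m y) => //; rewrite add0n leqNgt uv.
  exists y => //; rewrite mem_filter mem_enum andbT; apply/hasP; exists w => //.
  exact: lt_mem.
(* The condition restricts to [s]: a witness below [v] is below [u], hence is not [u]. *)
apply: IH => // [v vs|v w vs ws wv]; first by apply: ds; rewrite mem_rcons inE vs orbT.
have [||y [vw [w' ws' [wv' wy']]]] := lq v w _ _ wv.
- by rewrite mem_rcons inE vs orbT.
- by rewrite mem_rcons inE ws orbT.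
exists y; split=> //; exists w' => //; apply: lt_mem => //.
exact: Order.POrderTheory.lt_trans wv' (su _ vs).
Qed.

Definition exchange S : Prop := forall u v, S u -> S v ->
  forall x, (v x < u x)%N -> exists2 y, (u y < v y)%N & S (u - U_(x) + U_(y))%MM.

(** In a fixed degree the order is lexicographic. If [w < v] first differ at [i], then [w i < v i],
    and exchanging [i] in [v] for some [y] gives a generator dividing [v + U_(y)]. Since
    [v y < w y], the index [y] comes after [i], so the new generator is below [v]. *)
Lemma exchange_linearly_resolved d (T : pred 'X_{1..N}) :
  exchange (fun u => T u /\ mdeg u = d) ->
  linearly_resolved d (mono_ideal (k := k) (fun u => T u /\ mdeg u = d)).
Proof.
move=> exT.
(* The monomials of degree at most [d] form a finite type, from which the list of generators is
   extracted. *)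
pose s0 : seq 'X_{1..N} := [seq val m | m : 'X_{1..N < d.+1}].
pose s := sort <=%O [seq u <- s0 | T u && (mdeg u == d)].
have sE u : u \in s <-> T u /\ mdeg u = d.
  rewrite mem_sort mem_filter; split=> [/andP[/andP[-> /eqP->]] //|[-> du]].
  rewrite du eqxx /=; have ud : (mdeg u < d.+1)%N by rewrite du.
  by apply/mapP; exists (BMultinom ud); rewrite // mem_enum.
apply: linearly_resolved_eq (linearly_resolved_quotients (s := s) _ _ _).
- exact: eq_mono_ideal.
- rewrite -sorted_pairwise; last exact: Order.POrderTheory.lt_trans.
  rewrite Order.TotalTheory.sort_lt_sorted filter_uniq // map_inj_uniq ?enum_uniq //.
  exact: val_inj.
- by move=> u /sE[].
move=> v w vs ws wv.
have [[Tv dv] [Tw dw]] := (proj1 (sE v) vs, proj1 (sE w) ws).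
have [|i eqi lti] := ltmcP _ wv; first by rewrite dw dv.
have [y vy [Tw' dw']] := exT v w (conj Tv dv) (conj Tw dw) i lti.
have ne_yi : (y == i) = false.
  by apply/eqP => yi; move: vy; rewrite yi ltnNge (ltnW lti).
exists y; split=> //; exists (v - U_(i) + U_(y))%MM; first exact/sE.
split; last first.
  by apply/mnm_lepP => j; rewrite !mnmDE mnmBE leq_add2r leq_subr.
apply/ltmcP; first by rewrite dw' dv.
exists i => [j ji|].
  have ij : (i == j) = false by rewrite -val_eqE /= gtn_eqF.
  rewrite mnmDE mnmBE !mnm1E ij subn0.
  case: (y =P j) => [yj|]; last by rewrite /= addn0.
  have /eqi jE : (j < i)%N by [].
  by move: vy; rewrite yj jE ltnn.
rewrite mnmDE mnmBE !mnm1E eqxx ne_yi addn0 subn1 prednK //.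
exact: leq_ltn_trans lti.
Qed.

End LinearQuotients.
(** * Monomials of bounded weight on disjoint blocks *)

Section Weights.
Variable N : nat.
Implicit Types (P : pred 'I_N) (u v m : 'X_{1..N}).

Definition weight P m : nat := (\sum_(i | P i) m i)%N.

Lemma weightD P m m' : weight P (m + m')%MM = (weight P m + weight P m')%N.
Proof. by rewrite -big_split; apply: eq_bigr => i _; rewrite mnmDE. Qed.

Lemma weight1 P i : weight P U_(i)%MM = P i.
Proof.
rewrite /weight (eq_bigr (fun j => (i == j) : nat)); last by move=> j _; rewrite mnm1E.
have [Pi|Pi] := boolP (P i).
  rewrite (bigD1 i) //= eqxx big1 ?addn0 // => j /andP[_]; rewrite eq_sym.
  by move=> /negPf->.
by rewrite big1 // => j Pj; case: eqP => // ij; rewrite ij Pj in Pi.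
Qed.

Lemma mdeg_weight P m : mdeg m = (weight P m + weight (predC P) m)%N.
Proof. by rewrite mdegE (bigID P). Qed.

(** A function [cl] naming the block of each variable, with [None] for variables in no block, makes
    the blocks disjoint by construction. *)
Definition outside_blocks (q : nat) (cl : 'I_N -> option 'I_q) (a : 'I_q -> nat) :
    pred 'X_{1..N} :=
  fun m => [forall l, a l <= weight (fun i => cl i != Some l) m]%N.

Lemma outside_blocks_up q (cl : 'I_N -> option 'I_q) a :
  up_closed (outside_blocks cl a).
Proof.
move=> m m' /forallP Tm; apply/forallP => l.
by rewrite weightD; apply: leq_trans (Tm l) (leq_addr _ _).
Qed.

(* If no y in the block of x or outside all blocks can be used, some block gains
   weight from u to v, and y is taken there. *)
Lemma exchange_outside_blocks q (cl : 'I_N -> option 'I_q) a d :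
  exchange (fun m => outside_blocks cl a m /\ mdeg m = d).
Proof.
move=> u v [/forallP Tu du] [/forallP Tv dv] x vux.
pose blk c := weight (fun i => cl i == c).
suff /existsP[y /andP[uvy cly]] : [exists y, (u y < v y)%N &&
    [|| cl y == cl x, cl y == None | blk (cl y) u < blk (cl y) v]%N].
  exists y => //.
  have xu : (U_(x) <= u)%MM by rewrite lep1mP -lt0n; apply: leq_ltn_trans vux.
  (* The change of weight under the exchange, stated additively to avoid truncated subtraction. *)
  have uE P : (weight P (u - U_(x) + U_(y))%MM + P x = weight P u + P y)%N.
    rewrite -!weight1 -!weightD; congr weight; rewrite -[in RHS](submK xu).
    by rewrite -!addmA [(U_(y) + _)%MM]addmC.
  split; last by move: (uE predT); rewrite /weight -!mdegE du => /addIn.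
  apply/forallP => l; move: (Tu l) (uE (fun i => cl i != Some l)) => /=.
  have [yl|yl] := eqVneq (cl y) (Some l); last first.
    move=> Tul; case: (cl x != _) => [/addIn-> //|].
    by rewrite addn0 => ->; apply: leq_trans Tul (leq_addr _ _).
  move: cly; rewrite yl /=; have [xl|xl] := eqVneq (cl x) (Some l).
    by move=> _ Tul; rewrite !addn0 => ->.
  (* Here weight 1 is lost outside block [l]. As [u] and [v] have equal degree and [v] is heavier on
     block [l], [u] is strictly heavier outside it, so the bound satisfied by [v] absorbs the
     loss. *)
  rewrite /= => blk_lt _; rewrite addn0 addn1 => uwE.
  rewrite -ltnS uwE; apply: leq_ltn_trans (Tv l) _.
  by move: du; rewrite -dv !(mdeg_weight (fun i => cl i == Some l)) => duv;
     rewrite -(ltn_add2l (blk (Some l) u)) duv ltn_add2r.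
(* Without such a [y], no class of [cl] is heavier in [v] than in [u], and the class of [x] is
   strictly lighter, against the equality of degrees. *)
apply: contraT; rewrite negb_exists => /forallP none.
have le_blk c : (blk c v <= blk c u)%N.
  have [/existsP[y /andP[/eqP <- uvy]]|] := boolP [exists y, (cl y == c) && (u y < v y)%N].
    by move: (none y); rewrite uvy /= !negb_or -leqNgt => /and3P[].
  rewrite negb_exists => /forallP le; apply: leq_sum => i ci.
  by move: (le i); rewrite ci /= -leqNgt.
have lt_blk : (blk (cl x) v < blk (cl x) u)%N.
  rewrite /blk /weight (bigD1 x) //= [ltnRHS](bigD1 x) //= -addSn leq_add //.
  apply: leq_sum => i /andP[ci _]; rewrite leqNgt; apply/negP => uvi.
  by move: (none i); rewrite uvi ci.
have degE (m : 'X_{1..N}) : mdeg m = (\sum_c blk c m)%N.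
  by rewrite mdegE (partition_big cl predT).
suff: (mdeg v < mdeg u)%N by rewrite du dv ltnn.
rewrite !degE.
by rewrite (bigD1 (cl x)) //= [ltnRHS](bigD1 (cl x)) //= -addSn leq_add // leq_sum.
Qed.

(** Each factor from the ideal contributes weight at least 1; conversely, a monomial of weight at
    least [a] has [a] variables of [P] split off one at a time. *)
Lemma ideal_pow_variables (k : fieldType) P a (f : {mpoly k[N]}) :
  ideal_pow (mono_ideal (fun m => exists2 i, P i & m = U_(i)%MM)) a f <->
  forall m, m \in msupp f -> (a <= weight P m)%N.
Proof.
split.
  move: f; apply: ideal_gen_supp.
    by move=> m m' le; rewrite weightD; apply: leq_trans le (leq_addr _ _).
  move=> _ [g [Ig ->]]; elim: a g Ig => [|a IH] g Ig m //.
  rewrite big_ord_recl => /msuppM_le /allpairsP[[m1 m2] /= [m1g m2g ->]].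
  have /mono_idealP/(_ _ m1g)[_ [i Pi ->] /submK <-] := Ig ord0.
  rewrite !weightD weight1 Pi addn1 addSn ltnS; apply: leq_trans (leq_addl _ _).
  by apply: IH m2g => t; apply: Ig.
move=> fa; apply: ideal_gen_of_supp => m /fa {f fa}; elim: a m => [|a IH] m am.
  have <- : 'X_[m] * \prod_(t < 0) 1 = 'X_[m] :> {mpoly k[N]}.
    by rewrite big_ord0 mulr1.
  apply: ideal_genMl.
  by apply: ideal_pow_prod => -[].
have [i /andP[Pi mi]] : exists i, P i && (0 < m i)%N.
  apply/existsP; apply: contraTT am; rewrite negb_exists => /forallP none.
  rewrite /weight big1 // => i Pi; move: (none i); rewrite Pi /= -eqn0Ngt.
  by move/eqP.
have im : (U_(i) <= m)%MM by rewrite lep1mP -lt0n.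
rewrite -(submK im) mpolyXD mulrC; apply: ideal_powSl.
  by apply: ideal_gen_sub; exists U_(i)%MM; first exists i.
by apply: IH; move: am; rewrite -[in weight _ _](submK im) weightD weight1 Pi addn1.
Qed.

End Weights.

(** A minimal generator is divisible by one of the given monomials and hence equal to it, so
    exchange among these monomials gives exchange among minimal generators. *)
Lemma polymatroidal_mono_ideal (k : fieldType) (N d : nat) (S : 'X_{1..N} -> Prop) :
  exchange (fun u => S u /\ mdeg u = d) ->
  polymatroidal (mono_ideal (k := k) (fun u => S u /\ mdeg u = d)).
Proof.
move=> exS; split.
- by exists (fun u => S u /\ mdeg u = d).
- exists d => f; split; last by apply: ideal_gen_sub_gen => g [].
  apply: ideal_gen_sub_gen => _ [u [Su du] ->]; apply: ideal_gen_sub; split.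
    by apply: ideal_gen_sub; exists u.
  by rewrite dhomogX; apply/eqP.
have minS u : min_generator (mono_ideal (k := k) (fun u => S u /\ mdeg u = d)) u ->
    S u /\ mdeg u = d.
  move=> [/mono_idealX[v Sv vu] minu]; rewrite -(minu v) //.
  by apply/mono_idealX; exists v; rewrite ?lepm_refl.
move=> u v /minS Su /minS Sv x vux; have [y uvy Sw] := exS u v Su Sv x vux.
by exists y => //; apply/mono_idealX; eexists; [exact: Sw | exact: lepm_refl].
Qed.
(** * Linear changes of coordinates *)

Section Substitution.
Variables (k : fieldType).

Lemma comp_mpolyA (N1 N2 N3 : nat) (lp : N1.-tuple {mpoly k[N2]})
    (lq : N2.-tuple {mpoly k[N3]}) f :
  (f \mPo lp) \mPo lq = f \mPo [tuple tnth lp i \mPo lq | i < N1].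
Proof.
rewrite [f \mPo lp]comp_mpolyEX [RHS]comp_mpolyEX raddf_sum; apply: eq_bigr => m _ /=.
rewrite comp_mpolyZ !comp_mpolyX rmorph_prod; congr (_ *: _).
by apply: eq_bigr => i _; rewrite rmorphXn tnth_mktuple.
Qed.

Lemma homog_comp_mpoly (N1 N2 : nat) (lq : N1.-tuple {mpoly k[N2]}) d f :
  (forall i, tnth lq i \is 1.-homog) -> f \is d.-homog -> f \mPo lq \is d.-homog.
Proof.
move=> hq /dhomogP hf; rewrite comp_mpolyEX big_seq; apply: rpred_sum => m /hf dm.
have <- : (\sum_i m i)%N = d by rewrite -mdegE.
apply: rpredZ; rewrite comp_mpolyX.
apply: (big_ind2 (fun (f : {mpoly k[N2]}) e => f \is e.-homog)).
- exact: dhomog1.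
- by move=> *; apply: dhomogM.
by move=> i _; have := dhomogMn (m i) (hq i); rewrite mul1n.
Qed.

Lemma linear_formE N (f : {mpoly k[N]}) : f \is 1.-homog ->
  f = \sum_j f@_U_(j) *: 'X_j.
Proof.
move=> /dhomogP hf; apply/mpolyP => m; rewrite raddf_sum /=.
have [/eqP/mdeg1P[i /eqP->]|m1] := eqVneq (mdeg m) 1%N.
  rewrite (bigD1 i) //= mcoeffZ mcoeffXU eqxx mulr1 big1 ?addr0 // => j ji.
  by rewrite mcoeffZ mcoeffXU (negPf ji) mulr0.
rewrite big1 => [|j _]; first apply/eqP.
  by rewrite mcoeff_eq0; apply: contra m1 => /hf dm; apply/eqP.
by rewrite mcoeffZ mcoeffX; case: eqP => [jm|_]; rewrite ?mulr0 //; rewrite -jm mdeg1 in m1.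
Qed.

Lemma eq_component N (I J : {mpoly k[N]} -> Prop) d :
  ideal_eq I J -> ideal_eq (component I d) (component J d).
Proof.
by move=> IJ f; split; apply: ideal_gen_sub_gen => g [/IJ Ig hg]; apply: ideal_gen_sub.
Qed.

Section Isomorphism.
Variables (N : nat) (phi psi : {rmorphism {mpoly k[N]} -> {mpoly k[N]}}).
Hypotheses (phiK : cancel phi psi) (psiK : cancel psi phi).
Hypotheses (homog_phi : forall d f, f \is d.-homog -> phi f \is d.-homog).
Hypotheses (homog_psi : forall d f, f \is d.-homog -> psi f \is d.-homog).

(** Applying [psi] to all matrix entries turns a resolution of [J] into one of [I]: it preserves
    degrees, and [phi] carries kernels and images back. *)
Lemma linearly_resolved_iso d (I J : {mpoly k[N]} -> Prop) :
  (forall f, I f <-> J (phi f)) -> linearly_resolved d J -> linearly_resolved d I.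
Proof.
move=> IJ [b [A [D C]]].
have map_phiK m n (M : 'M_(m, n)) : map_mx psi (map_mx phi M) = M.
  by apply/matrixP => i j; rewrite !mxE phiK.
have map_psiK m n (M : 'M_(m, n)) : map_mx phi (map_mx psi M) = M.
  by apply/matrixP => i j; rewrite !mxE psiK.
have homog_map e m n (M : 'M_(m, n)) : homog_mx e M -> homog_mx e (map_mx psi M).
  by move=> /homog_mxP hM; apply/homog_mxP => i j; rewrite mxE homog_psi.
have ker m n (X : 'M_(m, n)) (v : 'rV_m) :
    v *m map_mx psi X = 0 <-> map_mx phi v *m X = 0.
  split=> [/(congr1 (map_mx phi))|/(congr1 (map_mx psi))].
    by rewrite map_mxM map_psiK map_mx0.
  by rewrite map_mxM map_phiK map_mx0.
have img m n (X : 'M_(m, n)) (v : 'rV_n) :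
    (exists w : 'rV_m, v = w *m map_mx psi X) <-> exists w : 'rV_m, map_mx phi v = w *m X.
  split=> [[w ->]|[w vw]]; first by exists (map_mx phi w); rewrite map_mxM map_psiK.
  by exists (map_mx psi w); rewrite -map_mxM -vw map_phiK.
exists b, (map_mx psi A), (fun i => map_mx psi (D i)); split.
- exact: homog_map (lc_aug C).
- by move=> i; apply: homog_map (lc_diff C i).
- move=> f; rewrite IJ (lc_onto C); split=> [[v vE]|[v ->]].
    by exists (map_mx psi v); rewrite -map_mxM mxE -vE phiK.
  by exists (map_mx phi v); rewrite -[A in RHS]map_psiK -map_mxM [RHS]mxE.
- by move=> v; rewrite ker img (lc_exact0 C).
by move=> i v; rewrite ker img (lc_exact C).
Qed.

Lemma component_iso d (I J : {mpoly k[N]} -> Prop) :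
  (forall f, I f <-> J (phi f)) -> forall f, component I d f <-> component J d (phi f).
Proof.
move=> IJ f; split.
  apply: rmorph_ideal_gen => g [Ig hg]; apply: ideal_gen_sub.
  by rewrite -IJ; split=> //; apply: homog_phi.
rewrite -{2}[f]phiK; apply: rmorph_ideal_gen => g [Jg hg]; apply: ideal_gen_sub.
by rewrite IJ psiK; split=> //; apply: homog_psi.
Qed.

End Isomorphism.
End Substitution.

Section CoordinateChange.
Variables (k : fieldType) (r : nat) (n : 'I_r -> nat).
Implicit Types (g : forall i : 'I_r, 'M[k]_((n i).+1)) (f : {mpoly k[nvars n]}).

Lemma coord_change_xvar g i (j : 'I_(n i).+1) :
  coord_change g (xvar k j) = \sum_l invmx (g i) l j *: xvar k l.
Proof.
rewrite /coord_change /xvar comp_mpolyXU -tnth_nth tnth_mktuple.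
(* The factor index occurs in types, so [tagnat.rankK] is rewritten under a function of the
   dependent pair. *)
pose F (p : {i & 'I_(n i).+1}) :=
  \sum_l invmx (g (tag p)) l (tagged p) *: (xvar k l : {mpoly k[nvars n]}).
by rewrite -[LHS]/(F (tagnat.sig (tagnat.Rank (p_ := fun i => (n i).+1) i j))) tagnat.rankK.
Qed.

Lemma coord_change_lincomb g m (c : 'I_m -> k) (F : 'I_m -> {mpoly k[nvars n]}) :
  coord_change g (\sum_l c l *: F l) = \sum_l c l *: coord_change g (F l).
Proof.
by rewrite /coord_change raddf_sum; apply: eq_bigr => l _ /=; rewrite comp_mpolyZ.
Qed.

Lemma xvarE (v : 'I_(nvars n)) : 'X_v = xvar k (tagnat.sig2 v) :> {mpoly k[nvars n]}.
Proof. by rewrite /xvar tagnat.sig2K. Qed.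

Lemma homog_xvar i (j : 'I_(n i).+1) : xvar k j \is 1.-homog.
Proof. by rewrite /xvar dhomogX; apply/eqP/mdeg1. Qed.

Lemma homog_coord_change g d f : f \is d.-homog -> coord_change g f \is d.-homog.
Proof.
apply: homog_comp_mpoly => v; rewrite tnth_mktuple.
by apply: rpred_sum => l _; apply/rpredZ/homog_xvar.
Qed.

Lemma coord_changeK g : (forall i, g i \in unitmx) ->
  cancel (coord_change g) (coord_change (fun i => invmx (g i))).
Proof.
move=> gU f; rewrite {1}/coord_change [X in X \mPo _]/coord_change comp_mpolyA.
rewrite -[RHS]comp_mpoly_id; congr (_ \mPo _); apply: eq_from_tnth => v.
rewrite !tnth_mktuple -/(coord_change _ _) xvarE.
transitivity (coord_change (fun i => invmx (g i)) (coord_change g (xvar k (tagnat.sig2 v)))).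
  by rewrite coord_change_xvar.
rewrite coord_change_xvar coord_change_lincomb; set i := tagnat.sig1 v; set j := tagnat.sig2 v.
under eq_bigr => l _ do rewrite coord_change_xvar scaler_sumr invmxK.
(* After exchanging the sums, the [t]-th variable has as coefficient the [(t, j)] entry of
   [g i *m invmx (g i)]. *)
rewrite exchange_big /= (bigD1 j) //= [X in _ + X]big1 ?addr0 => [|t tj];
  under eq_bigr do rewrite scalerA.
  rewrite -scaler_suml [X in X *: _](_ : _ = (g i *m invmx (g i)) j j).
    by rewrite mulmxV // mxE eqxx scale1r.
  by rewrite mxE; apply: eq_bigr => l _; rewrite mulrC.
rewrite -scaler_suml [X in X *: _](_ : _ = (g i *m invmx (g i)) t j).
  by rewrite mulmxV // mxE (negPf tj) scale0r.
by rewrite mxE; apply: eq_bigr => l _; rewrite mulrC.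
Qed.

Lemma coord_changeVK g : (forall i, g i \in unitmx) ->
  cancel (coord_change (fun i => invmx (g i))) (coord_change g).
Proof.
move=> gU f; have := @coord_changeK (fun i => invmx (g i)) _ f.
rewrite /coord_change; under eq_mktuple do under eq_bigr do rewrite invmxK.
by apply=> i; rewrite unitmx_inv.
Qed.

Lemma incl_linear i (f : {mpoly k[(n i).+1]}) : f \is 1.-homog ->
  incl f = \sum_j f@_U_(j) *: xvar k j.
Proof.
move=> /linear_formE {1}->; rewrite /incl raddf_sum /=; apply: eq_bigr => j _.
by rewrite comp_mpolyZ comp_mpolyXU -tnth_nth tnth_mktuple.
Qed.

Lemma meval_linear i (f : {mpoly k[(n i).+1]}) x : f \is 1.-homog ->
  f.@[x] = \sum_j f@_U_(j) * x j.
Proof.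
move=> /linear_formE {1}->; rewrite raddf_sum /=; apply: eq_bigr => j _.
by rewrite mevalZ mevalXU.
Qed.

(** * The ideal of a point moved to a coordinate vertex *)

Section Vertex.
Variables (p : mpoint k n) (g : forall i : 'I_r, 'M[k]_((n i).+1)).
Variable jj : forall i, 'I_(n i).+1.
Hypothesis gU : forall i, g i \in unitmx.
Hypothesis pg : forall i, (p i *m g i == (delta_mx 0 (jj i) : 'rV[k]_(n i).+1))%MS.
Variable L : forall i : 'I_r, 'I_(n i) -> {mpoly k[(n i).+1]}.
Arguments L : clear implicits.
Hypothesis hL : forall i, defining_forms (p i) (L i).

Definition vertex_ideal : {mpoly k[nvars n]} -> Prop :=
  mono_ideal (fun m => exists2 v : 'I_(nvars n),
    jj (tagnat.sig1 v) != tagnat.sig2 v & m = U_(v)%MM).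

Lemma defining_forms_eval i j : (L i j).@[fun t => p i 0 t] = 0.
Proof.
have /(hL i).2 : ideal_gen (fun h => exists j, h = L i j) (L i j).
  by apply: ideal_gen_sub; exists j.
move: (L i j); apply: ideal_gen_ind; first by rewrite meval0.
  by move=> f h; rewrite mevalD => -> ->; rewrite addr0.
by move=> c h [_ h0]; rewrite mevalM h0 mulr0.
Qed.

Lemma xvar_vertex i (t : 'I_(n i).+1) : t != jj i -> vertex_ideal (xvar k t).
Proof.
move=> tj; apply: ideal_gen_sub; rewrite /xvar; eexists; last reflexivity.
eexists; last reflexivity.
pose F (q : {i & 'I_(n i).+1}) := jj (tag q) != tagged q.
rewrite -[X in is_true X]/(F (tagnat.sig (tagnat.Rank (p_ := fun i => (n i).+1) i t))).
by rewrite tagnat.rankK /F eq_sym.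
Qed.

(** In a transformed defining form, the coefficient of the variable [jj i] is the value of the form
    at row [jj i] of [invmx (g i)]. That row is a multiple of [p i], so the coefficient vanishes. *)
Lemma mpoint_ideal_coord_change f : mpoint_ideal L f -> vertex_ideal (coord_change g f).
Proof.
apply: rmorph_ideal_gen => _ [i [j ->]]; have hj := (hL i).1 j.
change (vertex_ideal (coord_change g (incl (L i j)))); rewrite (incl_linear hj).
rewrite coord_change_lincomb.
under eq_bigr => l _ do rewrite coord_change_xvar scaler_sumr.
rewrite exchange_big /=; apply: ideal_gen_sum => t _.
under eq_bigr do rewrite scalerA; rewrite -scaler_suml -mul_mpolyC.
have [->|/xvar_vertex tj] := eqVneq t (jj i); last exact: ideal_genMl.
rewrite [X in X%:MP](_ : _ = 0) ?mpolyC0 ?mul0r; first exact: ideal_gen0.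
have /andP[_ /submxP[D De]] := pg i.
have rowE' : row (jj i) (invmx (g i)) = D *m p i.
  by rewrite rowE De -!mulmxA mulmxV // mulmx1.
have coefE l : invmx (g i) (jj i) l = D 0 0 * p i 0 l.
  by move/rowP/(_ l): rowE'; rewrite !mxE big_ord1.
have := defining_forms_eval j; rewrite (meval_linear _ hj) => Lp.
under eq_bigr do rewrite coefE mulrCA; by rewrite -mulr_sumr Lp mulr0.
Qed.

(** A variable [t] other than [jj i] pulls back to the linear form [l] whose coefficients are column
    [t] of [g i]. Its value at [p i] is entry [t] of [p i *m g i], a multiple of the vertex [jj i],
    hence 0. *)
Lemma vertex_ideal_coord_change f :
  vertex_ideal f -> mpoint_ideal L (coord_change (fun i => invmx (g i)) f).
Proof.
apply: rmorph_ideal_gen => _ [_ [v jv ->] ->].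
move: jv; rewrite xvarE; set i := tagnat.sig1 v; set t := tagnat.sig2 v => jt.
change (mpoint_ideal L (coord_change (fun i => invmx (g i)) (xvar k t))).
pose l := \sum_m g i m t *: 'X_m : {mpoly k[(n i).+1]}.
have hl : l \is 1.-homog.
  by apply: rpred_sum => m _; apply: rpredZ; rewrite dhomogX; apply/eqP/mdeg1.
have lE m : l@_U_(m) = g i m t.
  rewrite raddf_sum (bigD1 m) //= mcoeffZ mcoeffXU eqxx mulr1 big1 ?addr0 // => q qm.
  by rewrite mcoeffZ mcoeffXU (negPf qm) mulr0.
rewrite coord_change_xvar invmxK.
have -> : \sum_m g i m t *: xvar k m = incl l.
  by rewrite incl_linear //; apply: eq_bigr => m _; rewrite lE.
have /(hL i).2 : point_ideal (p i) l.
  apply: ideal_gen_sub; split; first by exists 1%N.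
  rewrite meval_linear //; have /andP[/submxP[D De] _] := pg i.
  transitivity ((p i *m g i) 0 t).
    by rewrite mxE; apply: eq_bigr => m _; rewrite lE mulrC.
  by rewrite De !mxE big_ord1 mxE (eq_sym t) (negPf jt) andbF mulr0.
apply: rmorph_ideal_gen => _ [j ->].
by apply: ideal_gen_sub; exists i, j.
Qed.

End Vertex.
End CoordinateChange.
(** * Points in linear general position *)

Section GeneralPosition.
Variables (k : fieldType) (r : nat) (n : 'I_r -> nat) (s : nat).
Variable P : 'I_s.+1 -> mpoint k n.
Hypotheses (hP : forall l, valid_point (P l)) (hs : forall i, (s <= n i)%N).
Hypothesis hgen : linear_general_position P.

Definition coords i : 'M[k]_(s.+1, (n i).+1) := \matrix_l P l i.

Lemma min_dim_le q (d : 'I_q -> nat) i : (min_dim d <= d i)%N.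
Proof.
rewrite /min_dim; move: (\max_(j < q) d j)%N => x.
have: i \in index_enum 'I_q by rewrite mem_index_enum.
elim: (index_enum _) => // j e IH; rewrite inE big_cons => /orP[/eqP->|/IH le].
  exact: geq_minl.
exact: leq_trans (geq_minr _ _) le.
Qed.

(** The first [\rank M] rows of the invertible matrix [row_ebase M] span the row space of [M];
    taking [t] rows enlarges it to a subspace of prescribed dimension. *)
Lemma submx_pid_row_ebase m p t (M : 'M[k]_(m, p)) :
  (\rank M <= t)%N -> (M <= (pid_mx t : 'M_p) *m row_ebase M)%MS.
Proof.
move=> rt; rewrite -{1}[M]mulmx_ebase.
have -> : pid_mx (\rank M) = (pid_mx (\rank M) : 'M_(m, p)) *m (pid_mx t : 'M[k]_p).
  rewrite mul_pid_mx; congr pid_mx; rewrite (minn_idPl rt).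
  by apply/esym/minn_idPr/rank_leq_col.
by rewrite mulmxA -[X in (X <= _)%MS]mulmxA submxMl.
Qed.

(** If the [i]-th coordinates were dependent, they would lie in a linear subspace of dimension
    [s.-1]. Taking the whole space in every other factor gives a subspace containing all [s.+1]
    points, while general position allows at most [s]. *)
Lemma coords_free i : row_free (coords i).
Proof.
rewrite /row_free eqn_leq rank_leq_row ltnNge; apply/negP => rk_le.
(* A single point has a nonzero coordinate vector, which is independent; hence [s.-1] below is a
   true predecessor. *)
have s_gt0 : (0 < s)%N.
  rewrite lt0n; apply/eqP => s0; move: rk_le; rewrite [X in (_ <= X)%N]s0 leqn0 mxrank_eq0.
  move=> /eqP M0; have := hP ord0 i; rewrite (_ : P ord0 i = row ord0 (coords i)).
    by rewrite M0 row0 eqxx.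
  by rewrite rowK.
pose d (i' : 'I_r) := if i' == i then s.-1 else n i'.
pose U i' : 'M[k]_((n i').+1) := pid_mx (d i').+1 *m row_ebase (coords i').
have di : d i = s.-1 by rewrite /d eqxx.
have d_le i' : (d i' <= n i')%N.
  by rewrite /d; case: eqP => // ->; apply: leq_trans (leq_pred _) (hs i).
have d_lt : exists j, (d j < n j)%N by exists i; rewrite di prednK.
have rkU i' : \rank (U i') = (d i').+1.
  by rewrite mxrankMfree ?row_free_unit ?row_ebase_unit // rank_pid_mx // ltnS.
have := hgen d_le d_lt rkU; rewrite (_ : [set l | _] = setT).
  rewrite cardsT card_ord ltnS => /leq_trans/(_ (min_dim_le d i)).
  by rewrite di -ltnS prednK // ltnn.
apply/setP => l; rewrite !inE; apply/forallP => i'.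
rewrite (_ : P l i' = row l (coords i')); last by rewrite rowK.
apply: submx_trans (row_sub _ _) _; apply: submx_pid_row_ebase.
by rewrite /d; case: eqP => [->|_]; rewrite ?prednK // rank_leq_col.
Qed.

Lemma vertices_exist : exists g : forall i : 'I_r, 'M[k]_((n i).+1), takes_to_vertices P g.
Proof.
have ex i : {g : 'M[k]_((n i).+1) | g \in unitmx & coords i *m g = pid_mx s.+1}.
  have Mf : coords i *m (pinvmx (coords i) *m (pid_mx s.+1 : 'M_(s.+1, (n i).+1)))
      = pid_mx s.+1 by rewrite mulmxA mulmxVp ?coords_free // mul1mx.
  (* The pseudo-inverse yields a matrix, possibly singular, that sends the [l]-th point to the
     [l]-th vertex; as it preserves the rank of [coords i], an invertible matrix acts on [coords i]
     in the same way. *)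
  have [|g gU gE] := @complete_unitmx _ _ _ (coords i)
      (pinvmx (coords i) *m (pid_mx s.+1 : 'M_(s.+1, (n i).+1))).
    by rewrite Mf rank_pid_mx ?ltnS //; apply/esym/eqP/coords_free.
  by exists g; rewrite // -gE.
exists (fun i => s2val (ex i)); split=> [i|l i]; first exact: s2valP (ex i).
pose j := widen_ord (hs i : (s.+1 <= (n i).+1)%N) l; exists j.
rewrite (_ : _ *m _ = delta_mx 0 j); first by rewrite submx_refl.
transitivity (row l (coords i *m s2val (ex i))); first by rewrite row_mul rowK.
rewrite (s2valP' (ex i)); apply/rowP => q; rewrite !mxE eqxx /= ltn_ord andbT.
by rewrite -val_eqE eq_sym.
Qed.

(** Two points sent to the same vertex in one factor would have proportional coordinates there,
    against independence. This makes the blocks of variables disjoint. *)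
Lemma vertex_inj g (jj : 'I_s.+1 -> forall i, 'I_(n i).+1) :
  (forall i, g i \in unitmx) ->
  (forall l i, (P l i *m g i == (delta_mx 0 (jj l i) : 'rV[k]_(n i).+1))%MS) ->
  forall i l l', jj l i = jj l' i -> l = l'.
Proof.
move=> gU gP i l l' jE; apply/eqP; apply: contraT => ll'.
have /submxP[D De] : (P l i <= P l' i)%MS.
  rewrite -(submxMfree _ _ (C := g i)) ?row_free_unit ?gU //.
  have /andP[h _] := gP l i; have /andP[_ h'] := gP l' i.
  by apply: submx_trans h _; rewrite jE.
have rE q : P q i = delta_mx 0 q *m coords i by rewrite -rowE rowK.
move: De; rewrite !rE mulmxA => /(row_free_inj (coords_free i))/rowP/(_ l).
by rewrite !mxE !eqxx big_ord1 !mxE (negPf ll') andbF mulr0 => /eqP; rewrite oner_eq0.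
Qed.

End GeneralPosition.

(** * The ideal of the fat points in vertex coordinates *)

Section FatPoints.
Variables (k : fieldType) (r : nat) (n : 'I_r -> nat) (s : nat).
Variable P : 'I_s.+1 -> mpoint k n.
Hypotheses (hP : forall l, valid_point (P l)) (hs : forall i, (s <= n i)%N).
Hypothesis hgen : linear_general_position P.
Variable L : forall (l : 'I_s.+1) (i : 'I_r), 'I_(n i) -> {mpoly k[(n i).+1]}.
Arguments L : clear implicits.
Hypothesis hL : forall l i, defining_forms (P l i) (L l i).
Variable a : 'I_s.+1 -> nat.
Variable g : forall i : 'I_r, 'M[k]_((n i).+1).
Hypothesis gP : takes_to_vertices P g.

Lemma transformed_inv (I : {mpoly k[nvars n]} -> Prop) f :
  transformed g I f <-> I (coord_change (fun i => invmx (g i)) f).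
Proof.
split=> [[h Ih ->]|If]; first by rewrite coord_changeK //; exact: gP.1.
by exists (coord_change (fun i => invmx (g i)) f); rewrite ?coord_changeVK //; exact: gP.1.
Qed.

Lemma transformed_fat_points : exists cl : 'I_(nvars n) -> option 'I_s.+1,
  ideal_eq (transformed g (fat_points_ideal L a)) (mono_ideal (outside_blocks cl a)).
Proof.
have [gU gV] := gP.
pose jj l i := xchoose (gV l i).
have jjP l i : (P l i *m g i == (delta_mx 0 (jj l i) : 'rV[k]_(n i).+1))%MS.
  exact: xchooseP (gV l i).
(* Block [l] consists of the variables not vanishing at the [l]-th vertex point. By [vertex_inj] at
   most one [l] qualifies for each variable, so the choice made by [pick] is forced. *)
pose cl (v : 'I_(nvars n)) := [pick l | jj l (tagnat.sig1 v) == tagnat.sig2 v].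
have clE v l : (cl v != Some l) = (jj l (tagnat.sig1 v) != tagnat.sig2 v).
  rewrite /cl; case: pickP => [l' /eqP jl'|->] //; congr (~~ _).
  apply/eqP/eqP => [[<-] //|jl]; congr Some.
  by apply: (vertex_inj hP hs hgen gU jjP (i := tagnat.sig1 v)); rewrite jl jl'.
exists cl => f; rewrite transformed_inv (up_closed_mono_ideal _ (@outside_blocks_up _ _ cl a)).
have powE l : ideal_pow (mpoint_ideal (L l)) (a l) (coord_change (fun i => invmx (g i)) f)
    <-> forall m, m \in msupp f -> (a l <= weight (fun i => cl i != Some l) m)%N.
  rewrite -(ideal_pow_variables (fun i => cl i != Some l)); split.
    rewrite -{2}[f](coord_changeVK gU); apply: rmorph_ideal_pow => h.
    move/(mpoint_ideal_coord_change gU (jjP l) (hL l)).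
    by apply: ideal_gen_sub_gen => _ [_ [v jv ->] ->]; apply: ideal_gen_sub;
       exists U_(v)%MM => //; exists v; rewrite // clE.
  apply: rmorph_ideal_pow => h Vh; apply: (vertex_ideal_coord_change (jjP l) (hL l)).
  by apply: ideal_gen_sub_gen Vh => _ [_ [v jv ->] ->]; apply: ideal_gen_sub;
     exists U_(v)%MM => //; exists v; rewrite // -clE.
split=> [Ff m mf|Tf l]; first by apply/forallP => l; apply: (proj1 (powE l) (Ff l)).
by apply/powE => m /Tf/forallP.
Qed.

Lemma component_transformed d : exists cl : 'I_(nvars n) -> option 'I_s.+1,
  ideal_eq (component (transformed g (fat_points_ideal L a)) d)
    (mono_ideal (fun m => outside_blocks cl a m /\ mdeg m = d)).
Proof.
have [cl clE] := transformed_fat_points; exists cl => f.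
rewrite (eq_component _ clE); exact/component_mono_ideal/outside_blocks_up.
Qed.

End FatPoints.

Lemma eq_polymatroidal (k : fieldType) N (I J : {mpoly k[N]} -> Prop) :
  ideal_eq I J -> polymatroidal J -> polymatroidal I.
Proof.
move=> IJ [[S JS] [d Jd] exJ]; split.
- by exists S => f; rewrite IJ.
- by exists d => f; rewrite IJ Jd; apply: eq_component => h; rewrite IJ.
have minIJ u : min_generator I u -> min_generator J u.
  by move=> [/IJ Ju minu]; split=> // v /IJ; apply: minu.
move=> u v /minIJ Ju /minIJ Jv x vux; have [y uvy Jw] := exJ u v Ju Jv x vux.
by exists y => //; apply/IJ.
Qed.

Theorem theorem6p11 (k : fieldType) (r : nat) (n : 'I_r -> nat)
    (hr : (1 <= r)%N) (hn : forall i, (1 <= n i)%N)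
    (s : nat) (hs : forall i, (s <= n i)%N)
    (P : 'I_s.+1 -> mpoint k n)
    (hP : forall l, valid_point (P l))
    (hdist : forall l l', l <> l' -> ~~ same_point (P l) (P l'))
    (hgen : linear_general_position P)
    (L : forall (l : 'I_s.+1) (i : 'I_r), 'I_(n i) -> {mpoly k[(n i).+1]})
    (hL : forall l i, defining_forms (P l i) (L l i))
    (a : 'I_s.+1 -> nat) (ha : forall l, (0 < a l)%N) :
  [/\ exists g : forall i : 'I_r, 'M[k]_((n i).+1), takes_to_vertices P g,
      forall g : forall i : 'I_r, 'M[k]_((n i).+1), takes_to_vertices P g ->
        monomial_ideal (transformed g (fat_points_ideal L a)) /\
        forall d : nat,
          polymatroidal (component (transformed g (fat_points_ideal L a)) d)
    & componentwise_linear (fat_points_ideal L a)].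
Proof.
have [g0 gP0] := vertices_exist hP hs hgen.
split; first by exists g0.
  move=> g gP; split=> [|d].
    have [cl clE] := transformed_fat_points hP hs hgen hL a gP.
    by exists (outside_blocks cl a).
  have [cl clE] := component_transformed hP hs hgen hL a gP d.
  apply: eq_polymatroidal clE _; apply: polymatroidal_mono_ideal.
  exact: exchange_outside_blocks.
(* The component is resolved in the coordinates given by [g0], and the resolution is carried back
   along the graded automorphism [coord_change g0]. *)
move=> d; apply: linearly_resolved_resolution.
have [cl clE] := component_transformed hP hs hgen hL a gP0 d.
have res : linearly_resolved d (component (transformed g0 (fat_points_ideal L a)) d).
  apply: linearly_resolved_eq
    (exchange_linearly_resolved k (@exchange_outside_blocks _ _ cl a d)).
  by move=> f; rewrite clE.
have [gU _] := gP0.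
have K := coord_changeK gU; have VK := coord_changeVK gU.
have h1 := @homog_coord_change k r n g0.
have h2 := @homog_coord_change k r n (fun i => invmx (g0 i)).
apply: (linearly_resolved_iso K VK h2 _ res); apply: (component_iso K VK h1 h2) => f.
have := transformed_inv gP0 (fat_points_ideal L a) (coord_change g0 f).
rewrite K => tfE; exact: iff_sym tfE.
Qed.
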